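(* Let $M_1,\dots,M_n$ be positive integers with sum $Z$, and let $\mathbf{p}=(M_1/Z,\dots,M_n/Z)$. Then any exact entropy-optimal sampler whose output distribution is $\mathbf{p}$ needs at most $Z-1$ bits of precision; that is, there is an entropy-optimal DDG tree with output distribution exactly $\mathbf{p}$ that uses at most $Z-1$ bits of precision.
   Context: Random bit model: a source supplies independent fair bits. A sampler is described by its discrete distribution generating (DDG) tree $T=(S,r,n,c,\delta)$: $S\subseteq\mathbb{N}$ a set of nodes, $r\in S$ the root, $c:S\to\{1,\dots,n\}\cup\{\mathsf{branch}\}$ labels nodes as branch nodes or leaves labelled by outcomes, $\delta:S\times\{0,1\}\to S$ the transition function. Sampling starts at $r$; at a branch node a fresh fair bit $b$ is drawn and the sampler moves to $\delta(\text{node},b)$; at a leaf labelled $i$ it outputs $i$. $\delta$ may contain back-edges (so a finite $S$ may encode an infinite tree). The output distribution is $(p_1,\dots,p_n)$ with $p_i$ the probability of halting with output $i$; a sampler is exact for $\mathbf{p}$ if its output distribution equals $\mathbf{p}$. $T$ is entropy-optimal if its expected number of consumed bits is minimal among all DDG trees with the same output distribution. $T$ uses $k$ bits of precision if $S$ is finite and the longest simple path through $\delta$ from $r$ to any leaf has exactly $k$ edges. *)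

(* Defs.v *)
From HB Require Import structures.
From mathcomp Require Import all_boot all_order all_algebra.
From mathcomp Require Import all_classical all_reals all_analysis.

Set Implicit Arguments.
Unset Strict Implicit.
Unset Printing Implicit Defensive.

Import Order.TTheory GRing.Theory Num.Theory.

Local Open Scope classical_set_scope.
Local Open Scope ring_scope.
Local Open Scope ereal_scope.

Section RandomBits.
Context (R : realType) (d : measure_display) (Omega : measurableType d).
Variables (P : probability Omega R) (b : nat -> {RV P >-> bool}).

Definition fair : Prop :=
  forall (k : nat) (v : bool), P (b k @^-1` [set v]) = (2^-1)%:E.

Definition mutually_independent : Prop :=
  forall (I : seq nat) (B : nat -> set bool), uniq I ->
    P (\bigcap_(k in [set` I]) (b k @^-1` B k))
      = \prod_(k <- I) P (b k @^-1` B k).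

Definition fair_bit_source : Prop := fair /\ mutually_independent.

End RandomBits.

(* The outcomes 1, ..., n are represented by 'I_n. The node type is the subtype
   of nat cut out by [nodes], so [ddg_root], [label] and [transition] live on S
   itself. Arbitrary [transition] is allowed: back-edges, sharing, and infinite S. *)
Record ddg (n : nat) := DDG {
  nodes : set nat;
  ddg_root : nodes;
  label : nodes -> option 'I_n; (* [None] is the label "branch" *)
  transition : nodes -> bool -> nodes }.

Section Sampling.
Context (n : nat).
Implicit Types (T : ddg n) (w : nat -> bool).

Definition is_branch T (s : nodes T) : bool := label s == None.

(* The node reached after [t] steps on the bit stream [w]; the sampler stays
   forever at the first leaf it reaches. Since every step before halting draws
   exactly one bit, the bit drawn at step [t] is [w t]. *)
Fixpoint visit T w (t : nat) : nodes T :=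
  if t is t'.+1 then
    let s := visit T w t' in if is_branch s then transition s (w t') else s
  else ddg_root T.

Definition halts_with T w (i : 'I_n) : Prop :=
  exists t, label (visit T w t) = Some i.

(* One bit is drawn per step spent at a branch node; the count is +oo when the
   sampler never halts. *)
Definition bits_consumed (R : realType) T w : \bar R :=
  \sum_(0 <= t <oo) (is_branch (visit T w t))%:R%:E.

End Sampling.

Section Distribution.
Context (R : realType) (d : measure_display) (Omega : measurableType d).
Variables (P : probability Omega R) (b : nat -> {RV P >-> bool}).
Context (n : nat).
Implicit Type T : ddg n.

Definition output_distribution T (i : 'I_n) : \bar R :=
  P [set x | halts_with T (fun k => b k x) i].

Definition expected_bits T : \bar R :=
  \int[P]_x bits_consumed R T (fun k => b k x).

Definition entropy_optimal T : Prop :=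
  forall T' : ddg n, output_distribution T' = output_distribution T ->
    expected_bits T <= expected_bits T'.

End Distribution.

Section Precision.
Context (n : nat).
Implicit Type T : ddg n.

(* [transition] is total, so leaves have outgoing edges too. *)
Definition edge T : rel (nodes T) :=
  fun s s' => [exists v : bool, transition s v == s'].

(* [p] lists the nodes after the root, so [size p] is the number of edges. *)
Definition simple_path_to_leaf T (p : seq (nodes T)) : bool :=
  [&& path (@edge T) (ddg_root T) p, uniq (ddg_root T :: p)
    & ~~ is_branch (last (ddg_root T) p)].

Definition uses_precision T (k : nat) : Prop :=
  [/\ finite_set (nodes T),
      exists2 p, simple_path_to_leaf p & @size (nodes T) p = k
    & forall p : seq (nodes T), simple_path_to_leaf p -> (size p <= k)%N].

End Precision.

(* Main.v *)
Require Import Defs.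
From HB Require Import structures.
From mathcomp Require Import all_boot all_order all_algebra.
From mathcomp Require Import cyclic.
From mathcomp Require Import all_classical all_reals all_analysis.
From mathcomp Require Import measurable_realfun.

(* Whatever an exact sampler does, the mass it has put on outcome [i] after [t]
   bits is a multiple of [2 ^- t] not exceeding [M i / Z]. Since the expected number
   of bits is the sum over [t] of the probability of still being at a branch node,
   a tree is entropy-optimal as soon as this mass is [floor (2 ^ t * M i / Z) / 2 ^ t]
   for all [t] and [i].
   Such a tree has at depth [t] as many branch nodes as the sum over [i] of the
   fractional parts of [2 ^ t * M i / Z], and these fractional parts are eventually
   periodic: if [Z = 2 ^ k * m] with [m] odd, then the preperiod is at most [k] and
   [totient m] is a period. So the tree folds into [k + totient m] levels, the last
   one leading back to level [k]. A simple path goes through level [k] at most once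
   for each of its at most [2 ^ k] nodes, so it has at most
   [k + 2 ^ k * totient m <= k + 2 ^ k * (m - 1) < 2 ^ k * m] edges if [m > 1];
   if [m = 1], level [k] has no branch node. *)

Set Implicit Arguments.
Unset Strict Implicit.
Unset Printing Implicit Defensive.

Import Order.TTheory GRing.Theory Num.Theory.
Import numFieldNormedType.Exports.

(** * Binary words of fixed length *)

Section Words.

Fixpoint words (t : nat) : seq (seq bool) :=
  if t is t'.+1 then [seq rcons u v | u <- words t', v <- [:: false; true]]
  else [:: [::]].

Lemma mem_words t u : (u \in words t) = (size u == t).
Proof.
elim: t u => [|t IHt] u; first by rewrite inE size_eq0.
apply/allpairsPdep/idP => [[u' [v [+ _ ->]]]|].
  by rewrite IHt size_rcons eqSS.
elim/last_ind: u => // u v _; rewrite size_rcons eqSS -IHt => hu.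
by exists u, v; split=> //; case: v.
Qed.

Lemma words_uniq t : uniq (words t).
Proof.
elim: t => [//|t IHt]; apply: allpairs_uniq => //.
by move=> [u v] [u' v'] _ _ /= /rcons_inj[-> ->].
Qed.

Lemma size_words t : size (words t) = 2 ^ t.
Proof.
elim: t => [//|t IHt].
by rewrite expnSr -IHt -(size_allpairs rcons _ [:: false; true]).
Qed.

End Words.

(** * Nodes reached after [t] bits, with multiplicity *)

Section Frontier.
Variables (n : nat) (T : ddg n).

Definition step (s : nodes T) (v : bool) : nodes T :=
  if is_branch s then transition s v else s.

Lemma step_branch s v : is_branch s -> step s v = transition s v.
Proof. by rewrite /step => ->. Qed.

Lemma step_leaf s v : ~~ is_branch s -> step s v = s.
Proof. by rewrite /step => /negbTE ->. Qed.

Definition has_label i (s : nodes T) := label s == Some i.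

Lemma visitS w t : visit T w t.+1 = step (visit T w t) (w t).
Proof. by []. Qed.

Lemma eq_visit w w' t : {in gtn t, w =1 w'} -> visit T w t = visit T w' t.
Proof.
elim: t => [//|t IHt] eqw; rewrite !visitS IHt ?eqw ?inE//.
by move=> k kt; apply: eqw; rewrite inE ltnW.
Qed.

Lemma visit_label w i t t' : t <= t' ->
  label (visit T w t) = Some i -> label (visit T w t') = Some i.
Proof.
move=> /subnK <-; elim: (t' - t) => [//|k IHk] /IHk lbl.
by rewrite addSn visitS /step /is_branch lbl.
Qed.

(** A node occurs once per word leading to it, so its multiplicity divided by [2 ^ t] is the
    probability of being there after [t] bits. *)
Definition frontier t := [seq visit T (nth false u) t | u <- words t].

Lemma frontierS t :
  frontier t.+1 = flatten [seq [:: step s false; step s true] | s <- frontier t].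
Proof.
rewrite /frontier (_ : words t.+1 = flatten
    [seq [:: rcons u false; rcons u true] | u <- words t])// map_flatten -!map_comp.
congr flatten; apply/eq_in_map => u; rewrite mem_words => /eqP szu /=.
have visitE v : visit T (nth false (rcons u v)) t.+1
    = step (visit T (nth false u) t) v.
  rewrite visitS nth_rcons szu ltnn eqxx; congr step.
  by apply: eq_visit => k; rewrite inE nth_rcons szu => ->.
by rewrite -!visitE.
Qed.

Lemma size_frontier t : size (frontier t) = 2 ^ t.
Proof. by rewrite size_map size_words. Qed.

(** A node is a branch or bears exactly one label, so few branch nodes at depth [t] means many
    labelled ones. *)
Lemma count_branch_frontier t :
  count (@is_branch n T) (frontier t)
    + \sum_i count (has_label i) (frontier t) = 2 ^ t.
Proof.
rewrite -size_frontier; elim: (frontier t) => [|s S IHS]/=.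
  by rewrite big1.
rewrite -IHS big_split/= addnACA -[RHS]add1n; congr (_ + _).
rewrite /is_branch /has_label; case: (label s) => [i|]; last by rewrite eqxx big1.
by rewrite (bigD1 i)//= eqxx big1 ?addn0// => j /negbTE ji; rewrite eqE/= eq_sym ji.
Qed.

End Frontier.

(** * Visit probabilities under fair independent bits *)

Section Probability.
Context (R : realType) (d : measure_display) (Omega : measurableType d).
Variables (P : probability Omega R) (b : nat -> {RV P >-> bool}).
Hypothesis hb : fair_bit_source b.
Local Open Scope classical_set_scope.
Local Open Scope ring_scope.

Let prefix t x := mkseq (b^~ x) t.

Let cylinderE u : [set x | prefix (size u) x = u] =
  \bigcap_(k in [set` iota 0 (size u)]) (b k @^-1` [set nth false u k]).
Proof.
apply/seteqP; split => x /=.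
  by move=> <- k /=; rewrite mem_iota size_mkseq/= add0n => kt; rewrite nth_mkseq.
move=> hx; apply: (@eq_from_nth _ false); rewrite size_mkseq// => k kt.
by rewrite nth_mkseq// hx//= mem_iota.
Qed.

Let measurable_cylinder u : measurable [set x | prefix (size u) x = u].
Proof.
rewrite cylinderE bigcap_seq; apply: bigsetI_measurable => k _.
exact: measurable_funPTI.
Qed.

Let cylinder_prob u :
  P [set x | prefix (size u) x = u] = (2^-1 ^+ size u)%:E.
Proof.
case: hb => fairb indepb.
rewrite cylinderE (indepb _ (fun k => [set nth false u k])) ?iota_uniq//.
rewrite (eq_bigr (fun=> 2^-1%:E)) => [|k _]; last exact: fairb.
by rewrite prodEFin big_const_seq count_predT size_iota iter_mulr_1.
Qed.

(** Cylinders of distinct words of length [t] are disjoint, and each has mass [2 ^- t]. *)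
Let words_prob t (W : seq (seq bool)) : uniq W -> all (fun u => size u == t) W ->
  measurable [set x | prefix t x \in W] /\
  P [set x | prefix t x \in W] = ((size W)%:R / 2 ^+ t)%:E.
Proof.
elim: W => [_ _|u W IHW /= /andP[uW unW] /andP[/eqP szu szW]].
  rewrite [X in measurable X /\ P X = _](_ : _ = set0); last by apply/seteqP; split.
  by rewrite measure0 mul0r; split.
have [mW PW] := IHW unW szW.
rewrite [X in measurable X /\ P X = _](_ : _ =
    [set x | prefix (size u) x = u] `|` [set x | prefix t x \in W]); last first.
  rewrite szu; apply/seteqP; split => x /=; rewrite inE.
    by case/predU1P; [left|right].
  by case=> ->; rewrite ?eqxx ?orbT.
split; first exact: measurableU.
transitivity (P [set x | prefix (size u) x = u] + P [set x | prefix t x \in W])%E.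
  apply: measureU => //; rewrite szu.
  by apply/seteqP; split => // x /= [->]; rewrite (negbTE uW).
by rewrite PW cylinder_prob szu -EFinD exprVn -[(size W).+1]addn1 natrD mulrDl mul1r addrC.
Qed.

Variables (n : nat) (T : ddg n).
Implicit Type Q : pred (nodes T).

Let visit_prob Q t :
  measurable [set x | Q (visit T (b^~ x) t)] /\
  P [set x | Q (visit T (b^~ x) t)]
    = ((count Q (frontier T t))%:R / 2 ^+ t)%:E.
Proof.
pose W := [seq u <- words t | Q (visit T (nth false u) t)].
have [||] := @words_prob t W; first by rewrite filter_uniq ?words_uniq.
  by apply/allP => u; rewrite mem_filter mem_words => /andP[].
rewrite size_filter /frontier count_map.
suff -> : [set x | prefix t x \in W] = [set x | Q (visit T (b^~ x) t)] by [].
have visitE x : visit T (nth false (prefix t x)) t = visit T (b^~ x) t.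
  by apply: eq_visit => k kt; rewrite nth_mkseq.
by apply/seteqP; split => x /=;
  rewrite mem_filter mem_words size_mkseq eqxx andbT visitE.
Qed.

Lemma measurable_visit Q t : measurable [set x | Q (visit T (b^~ x) t)].
Proof. exact: (visit_prob Q t).1. Qed.

Lemma prob_visit Q t : P [set x | Q (visit T (b^~ x) t)]
  = ((count Q (frontier T t))%:R / 2 ^+ t)%:E.
Proof. exact: (visit_prob Q t).2. Qed.

Let halts_bigcup i : [set x | halts_with T (b^~ x) i] =
  \bigcup_t [set x | has_label i (visit T (b^~ x) t)].
Proof.
apply/seteqP; split => [x [t lt]|x [t _ /eqP lt]]; exists t => //.
exact/eqP.
Qed.

(** Leaves are absorbing, so halting with [i] is an increasing union over [t], and continuity from
    below applies. *)
Lemma frontier_cvg_output i :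
  ((count (has_label i) (frontier T t))%:R / 2 ^+ t)%:E
    @[t --> \oo] --> output_distribution b T i.
Proof.
rewrite /output_distribution halts_bigcup.
under eq_fun do rewrite -prob_visit.
apply: nondecreasing_cvg_mu.
- by move=> t; apply: (measurable_visit (has_label i)).
- by apply: bigcup_measurable => t _; apply: (measurable_visit (has_label i)).
- move=> t t' tt'; apply/subsetPset => x /= /eqP lt; apply/eqP.
  exact: visit_label lt.
Qed.

Lemma frontier_le_output i t :
  (((count (has_label i) (frontier T t))%:R / 2 ^+ t)%:E
    <= output_distribution b T i)%E.
Proof.
rewrite -prob_visit /output_distribution halts_bigcup.
apply: le_measure; rewrite ?inE; first exact: (measurable_visit (has_label i)).
  by apply: bigcup_measurable => t' _; apply: measurable_visit.
by move=> x hx; exists t.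
Qed.

(** Integral and series are exchanged, the terms being nonnegative; each term is the indicator of
    still being at a branch node. *)
Lemma expected_bitsE : expected_bits b T =
  (\sum_(0 <= t <oo)
     ((count (@is_branch n T) (frontier T t))%:R / 2 ^+ t)%:E)%E.
Proof.
have mB t : measurable [set x | is_branch (visit T (b^~ x) t)].
  exact: measurable_visit.
rewrite /expected_bits /bits_consumed integral_nneseries//.
- apply: eq_eseriesr => t _; rewrite -prob_visit.
  rewrite -[in RHS](setIT [set x | _]) -integral_indic//.
  by apply: eq_integral => x _; rewrite indicE; congr (_%:R%:E); rewrite mem_setE.
- move=> t; apply/measurable_EFinP.
  rewrite (_ : (fun x => _) = \1_[set x | is_branch (visit T (b^~ x) t)]).
    exact: measurable_indic.
  by apply/funext => x; rewrite indicE mem_setE.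
Qed.

End Probability.

(** * Output and optimality of trees with floor counts *)

Section FloorOptimal.
Context (R : realType) (d : measure_display) (Omega : measurableType d).
Variables (P : probability Omega R) (b : nat -> {RV P >-> bool}).
Hypothesis hb : fair_bit_source b.
Variables (n : nat) (M : 'I_n -> nat) (Z : nat) (T : ddg n).
Hypothesis Z_gt0 : 0 < Z.
Hypothesis frontier_floor :
  forall t i, count (has_label i) (frontier T t) = (2 ^ t * M i) %/ Z.
Local Open Scope classical_set_scope.
Local Open Scope ring_scope.

Let Z0 : 0 < (Z%:R : R). Proof. by rewrite ltr0n. Qed.

Let floor_cvg (m : nat) :
  (((2 ^ t * m) %/ Z)%N%:R / 2 ^+ t : R) @[t --> \oo] --> (m%:R / Z%:R : R).
Proof.
have pow0 t : 0 < (2 : R) ^+ t by rewrite exprn_gt0.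
have floorE t : ((2 ^ t * m) %/ Z)%N%:R / 2 ^+ t
    = m%:R / Z%:R - ((2 ^ t * m) %% Z)%N%:R / Z%:R / 2 ^+ t :> R.
  have := divn_eq (2 ^ t * m) Z => /(congr1 (fun k => k%:R : R)).
  rewrite natrD !natrM natrX => e.
  apply: (mulIf (lt0r_neq0 (pow0 t))); rewrite mulrBl !divfK ?gt_eqF//.
  apply: (mulIf (lt0r_neq0 Z0)); rewrite mulrBl divfK ?gt_eqF//.
  rewrite mulrAC divfK ?gt_eqF// [m%:R * _]mulrC e addrK//.
(* The error is a remainder below [Z], divided by [Z] and by [2 ^+ t], hence at most the geometric
   term [2^-1 ^+ t]. *)
apply: (@squeeze_cvgr _ _ _ _ (fun t => m%:R / Z%:R - geometric 1 2^-1 t)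
  (fun=> m%:R / Z%:R)); last exact: cvg_cst.
  near=> t; rewrite floorE gerBl; apply/andP; split; last first.
    by rewrite !divr_ge0// ltW.
  rewrite lerD2l lerN2 /= mul1r exprVn -[leRHS]mul1r ler_pM2r ?invr_gt0//.
  by rewrite ler_pdivrMr// mul1r ler_nat ltnW// ltn_mod.
rewrite -[X in _ --> X]subr0; apply: cvgB; first exact: cvg_cst.
by apply: cvg_geometric; rewrite ger0_norm ?invr_ge0// invf_lt1// ltr1n.
Unshelve. all: by end_near. Qed.

Lemma floor_output i :
  output_distribution b T i = ((M i)%:R / Z%:R)%:E.
Proof.
have cvgT := frontier_cvg_output hb (T := T) (i := i).
apply: (cvg_unique _ cvgT) => //.
apply: cvg_EFin; first by near=> t.
under eq_fun do rewrite frontier_floor.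
exact: floor_cvg.
Unshelve. all: by end_near. Qed.

Lemma floor_entropy_optimal : entropy_optimal b T.
Proof.
move=> T' eqTT'; rewrite !expected_bitsE//; apply: lee_nneseries => t *.
  by rewrite lee_fin divr_ge0// exprn_ge0.
rewrite lee_fin ler_pM2r ?invr_gt0 ?exprn_gt0// ler_nat.
(* Both frontiers have [2 ^ t] entries: adding the label counts of [T] on both sides reduces the
   claim to those of [T'] being no larger. *)
rewrite -(leq_add2r (\sum_i count (has_label i) (frontier T t))%N).
rewrite count_branch_frontier -(count_branch_frontier T' t) leq_add2l.
apply: leq_sum => i _; rewrite frontier_floor leq_divRL//.
have := frontier_le_output hb T' i t.
rewrite eqTT' floor_output lee_fin ler_pdivrMr ?exprn_gt0// mulrAC.
by rewrite ler_pdivlMr// -natrX -!natrM ler_nat mulnC [X in (_ <= X)%N]mulnC mulnC.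
Qed.

End FloorOptimal.

(** * Simple paths compared with frontiers *)

Section SimplePaths.
Variables (n : nat) (T : ddg n).
Hypothesis leaf_loop : forall (s : nodes T) v, ~~ is_branch s -> transition s v = s.

(** Edges follow [transition] even at leaves, whereas the frontier follows [step], which stops
    there; self-loops at leaves reconcile the two. *)
Let step_transition s v : step s v = transition s v :> nodes T.
Proof. by rewrite /step; case: ifPn => // /leaf_loop. Qed.

Lemma path_frontier (p : seq (nodes T)) t : path (@edge _ T) (ddg_root T) p ->
  t <= size p -> nth (ddg_root T) (ddg_root T :: p) t \in frontier T t.
Proof.
move=> rp; elim: t => [|t IHt] tp; first by rewrite inE.
rewrite frontierS; apply/flatten_mapP; exists (nth (ddg_root T) (ddg_root T :: p) t).
  exact/IHt/ltnW.
have /existsP[v /eqP tv] := pathP (ddg_root T) rp t tp.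
rewrite -[nth _ _ t.+1]/(nth (ddg_root T) p t) -tv -step_transition.
by case: v {tv}; rewrite !inE eqxx ?orbT.
Qed.

Lemma frontier_path t s : s \in frontier T t ->
  exists2 p, path (@edge _ T) (ddg_root T) p & last (ddg_root T) p = s.
Proof.
elim: t s => [|t IHt] s; first by rewrite inE => /eqP ->; exists [::].
rewrite frontierS => /flatten_mapP[s' /IHt[p rp <-]] hs.
exists (rcons p s); last by rewrite last_rcons.
rewrite rcons_path rp; apply/existsP.
by move: hs; rewrite !inE => /orP[]/eqP ->; [exists false|exists true];
  rewrite step_transition.
Qed.

(** Shortening a path to the leaf [s] gives some simple path, and [K] bounds all of them, so a
    maximal length exists. *)
Lemma bounded_precision t s K : finite_set (nodes T) ->
  s \in frontier T t -> ~~ is_branch s ->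
  (forall p, @simple_path_to_leaf _ T p -> size p <= K) ->
  exists2 k, k <= K & uses_precision T k.
Proof.
move=> finT /frontier_path[p rp <-] leaf_s pK.
pose Q k := `[< exists2 q, @simple_path_to_leaf _ T q & size q = k >].
have exQ : exists k, Q k.
  case: (shortenP rp) leaf_s => q rq uq _ leaf_q.
  by exists (size q); apply/asboolP; exists q => //; apply/and3P.
have QK k : Q k -> k <= K by move=> /asboolP[q /pK qK <-].
have [k Qk kmax] := ex_maxnP exQ QK.
exists k; first exact: QK.
split => // [|q hq]; first exact/asboolP.
by apply: kmax; apply/asboolP; exists q.
Qed.

End SimplePaths.

(** Among the [m] residues, 0 is not coprime to [m > 1]. *)
Lemma totient_lt m : 1 < m -> totient m < m.
Proof.
move=> m_gt1; rewrite totient_count_coprime big_ltn ?(ltnW m_gt1)//.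
have -> : coprime m 0 = false by rewrite /coprime gcdn0; case: eqP m_gt1 => // ->.
rewrite add0n -[X in _ < X](prednK (ltnW m_gt1)) ltnS -subn1.
rewrite -[X in _ <= X]muln1 -sum_nat_const_nat; apply: leq_sum => i _.
exact: leq_b1.
Qed.

(** In the tree below, branch [a] of a level has entries [2a] and [2a + 1] of a list [L] as
    children; this reassembles [L]. *)
Lemma flatten_nth_pairs (S : Type) (x : S) (L : seq S) c : size L = c.*2 ->
  flatten [seq [:: nth x L a.*2; nth x L a.*2.+1] | a <- iota 0 c] = L.
Proof.
move=> szL; rewrite -[RHS](mkseq_nth x) szL /mkseq {szL}.
elim: c => [//|c IHc].
by rewrite -addn1 iotaD map_cat flatten_cat IHc doubleD iotaD map_cat /= !add0n.
Qed.

(** * Trees on an arbitrary finite state type *)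

Section FiniteTree.
Variables (n : nat) (F : finType) (r : F) (lab : F -> option 'I_n).
Variable (delta : F -> bool -> F).

(** The nodes of a [ddg] are naturals: a state is coded by its rank, below [#|F|]. *)
Definition fin_node (f : F) : `I_#|F| := ordII (enum_rank f).
Definition fin_state (s : `I_#|F|) : F := enum_val (IIord s).

Lemma fin_nodeK : cancel fin_node fin_state.
Proof. by move=> f; rewrite /fin_node /fin_state ordIIK enum_rankK. Qed.

Lemma fin_stateK : cancel fin_state fin_node.
Proof. by move=> s; rewrite /fin_node /fin_state enum_valK IIordK. Qed.

Definition fin_ddg : ddg n :=
  DDG (fin_node r) (lab \o fin_state) (fun s v => fin_node (delta (fin_state s) v)).

Lemma label_fin_node f : @label n fin_ddg (fin_node f) = lab f.
Proof. by rewrite /= fin_nodeK. Qed.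

End FiniteTree.

(** * Evolution of branches and labels from one depth to the next *)

Section Children.
Variables (n : nat) (T : ddg n).

Definition children (S : seq (nodes T)) :=
  flatten [seq [:: transition s false; transition s true] | s <- S].

(** Leaves only reproduce themselves, so branch nodes are children of branch nodes. *)
Lemma branch_frontierS t :
  seq.filter (@is_branch n T) (frontier T t.+1) =
    seq.filter (@is_branch n T) (children (seq.filter (@is_branch n T) (frontier T t))).
Proof.
rewrite frontierS; elim: (frontier T t) => [//|s S IHS] /=.
case: (boolP (is_branch s)) => sb.
  by rewrite (step_branch _ sb) (step_branch _ sb) /= IHS.
by rewrite !step_leaf// (negbTE sb).
Qed.

(** A leaf survives under both bits, whence the doubling; the second term counts leaves just
    reached. *)
Lemma label_frontierS i t :
  count (has_label i) (frontier T t.+1) = (count (has_label i) (frontier T t)).*2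
    + count (has_label i) (children (seq.filter (@is_branch n T) (frontier T t))).
Proof.
rewrite frontierS; elim: (frontier T t) => [//|s S IHS] /=.
rewrite {}IHS; case: (boolP (is_branch s)) => sb.
  rewrite !(step_branch _ sb) /= (_ : has_label i s = false); last first.
    by move: sb; rewrite /is_branch /has_label => /eqP ->.
  by rewrite add0n ![_ + (_.*2 + _)]addnCA.
by rewrite !step_leaf// doubleD addnA addnn addnA.
Qed.

End Children.

(** * The folded Knuth-Yao tree *)

Section KnuthYao.
Variables (n : nat) (M : 'I_n -> nat) (Z : nat).
Hypothesis M_gt0 : forall i, 0 < M i.
Hypothesis Z_gt0 : 0 < Z.
Hypothesis Z_sum : Z = \sum_i M i.

(* [remainder j i / Z] is the fractional part of [2 ^ j * M i / Z], so
   [width j] counts the branch nodes at depth [j] of the unfolded tree. *)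
Definition remainder j i := (2 ^ j * M i) %% Z.
Definition width j := (\sum_i remainder j i) %/ Z.

Lemma remainderS j i : remainder j.+1 i = (2 * remainder j i) %% Z.
Proof. by rewrite /remainder modnMmr mulnA expnS. Qed.

(** The division in [width] is exact: modulo [Z] the remainders sum to
    [2 ^ j * \sum_i M i = 2 ^ j * Z], that is to 0. *)
Lemma widthM j : width j * Z = \sum_i remainder j i.
Proof.
rewrite divnK// /dvdn; apply/eqP.
rewrite /remainder modn_summ -big_distrr/= -Z_sum.
by rewrite modnMl.
Qed.

Lemma width_leq j : width j <= n.
Proof.
rewrite -(leq_pmul2r Z_gt0) widthM -[n in _ <= n * _]card_ord -sum_nat_const.
by apply: leq_sum => i _; rewrite ltnW ?ltn_mod.
Qed.

Lemma width_leq_exp j : width j <= 2 ^ j.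
Proof.
rewrite -(leq_pmul2r Z_gt0) widthM Z_sum big_distrr/=.
by apply: leq_sum => i _; exact: leq_mod.
Qed.

Lemma width0 : width 0 + \sum_i M i %/ Z = 1.
Proof.
apply/eqP; rewrite -(eqn_pmul2r Z_gt0) mulnDl widthM mul1n big_distrl/= -big_split/=.
rewrite [X in _ == X]Z_sum; apply/eqP; apply: eq_bigr => i _.
by rewrite /remainder mul1n addnC -divn_eq.
Qed.

(** Euclidean division of each [2 * remainder j i] by [Z], summed over [i]: the children of a level
    are the branches of the next one and the new leaves. *)
Lemma widthS j : width j.+1 + \sum_i (2 * remainder j i) %/ Z = (width j).*2.
Proof.
apply/eqP; rewrite -(eqn_pmul2r Z_gt0) mulnDl widthM -mul2n -mulnA widthM.
rewrite !big_distrl big_distrr /= -big_split/=; apply/eqP; apply: eq_bigr => i _.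
by rewrite remainderS addnC -divn_eq.
Qed.

Lemma floorS j i : (2 ^ j.+1 * M i) %/ Z =
  ((2 ^ j * M i) %/ Z).*2 + (2 * remainder j i) %/ Z.
Proof.
rewrite expnS -mulnA {1}(divn_eq (2 ^ j * M i) Z) mulnDr mulnA divnMDl//.
by rewrite mul2n.
Qed.

Variables (k l : nat).
Hypothesis l_gt0 : 0 < l.
Hypothesis remainder_period : forall i, remainder (k + l) i = remainder k i.

Definition next_level j := if j.+1 == k + l then k else j.+1.
Definition level t := iter t next_level 0.

Let next_level_lt j : j < k + l -> next_level j < k + l.
Proof.
rewrite /next_level; case: eqP => [_ _|/eqP ne lt]; last by rewrite ltn_neqAle ne.
by rewrite -[X in X < _]addn0 ltn_add2l.
Qed.

Lemma level_lt t : level t < k + l.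
Proof.
by elim: t => [|t]; [rewrite addn_gt0 l_gt0 orbT|exact: next_level_lt].
Qed.

Lemma remainder_level t i : remainder (level t) i = remainder t i.
Proof.
elim: t => [//|t IHt]; rewrite remainderS -IHt -remainderS /= /next_level.
by case: eqP => // ->; rewrite remainder_period.
Qed.

Lemma width_level t : width (level t) = width t.
Proof. by congr (_ %/ _); apply: eq_bigr => i _; rewrite remainder_level. Qed.

Let iter_level c j : j + c < k + l -> iter c next_level j = j + c.
Proof.
elim: c => [|c IHc]; rewrite ?addn0// addnS => lt.
by rewrite iterS IHc ?(ltnW lt)// /next_level ltn_eqF.
Qed.

(** From level [k] on, [next_level] runs through a cycle of length [l]. *)
Lemma level_period c : level (k + c * l) = k.
Proof.
elim: c => [|c IHc].
  by rewrite addn0 /level iter_level// -[X in X < _]addn0 ltn_add2l.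
rewrite mulSn addnCA /level iterD -/(level _) IHc.
rewrite -[X in iter X]prednK// iterS iter_level ?ltn_add2l ?prednK//.
by rewrite /next_level -addnS prednK// eqxx.
Qed.

(** [inl (j, a)] is branch [a] of level [j], and [inr i] the single leaf for [i]. As
    [a < width j <= n], the range ['I_n.+1] suffices, and its successor form suits [inord]. *)
Let state : finType := ('I_(k + l) * 'I_n.+1 + 'I_n)%type.

Definition branch_state (j a : nat) : state :=
  inl (insubd (Ordinal (level_lt 0)) j, inord a).

Definition slots (j c : nat) (q : 'I_n -> nat) : seq state :=
  [seq branch_state j a | a <- iota 0 c]
    ++ flatten [seq nseq (q i) (inr i) | i <- enum 'I_n].

Let state_label (f : state) : option 'I_n := if f is inr i then Some i else None.

(** The default of [nth] is out of reach when [a < width j]: by [widthS] the list has [(width j).*2]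
    entries. *)
Let state_next (f : state) (v : bool) : state :=
  if f is inl (j, a) then
    nth (branch_state 0 0)
      (slots (next_level j) (width j.+1) (fun i => (2 * remainder j i) %/ Z))
      (a.*2 + v)
  else f.

(** By [width0] this list has exactly one entry: a leaf if [n = 1], a branch otherwise. *)
Let state_root := head (branch_state 0 0) (slots 0 (width 0) (fun i => M i %/ Z)).

Definition ky_tree : ddg n := fin_ddg state_root state_label state_next.
Let node : state -> nodes ky_tree := @fin_node state.

Lemma size_slots j c q : size (slots j c q) = c + \sum_i q i.
Proof.
rewrite size_cat size_map size_iota size_flatten /shape -map_comp; congr (_ + _).
by rewrite sumnE big_map big_enum; apply: eq_bigr => i _; rewrite /= size_nseq.
Qed.

Let is_branch_node f : is_branch (node f) = (state_label f == None).
Proof. by rewrite /is_branch label_fin_node. Qed.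

Let has_label_node i f : has_label i (node f) = (state_label f == Some i).
Proof. by rewrite /has_label label_fin_node. Qed.

Lemma branch_slots j c q : seq.filter (@is_branch n ky_tree) (map node (slots j c q)) =
  [seq node (branch_state j a) | a <- iota 0 c].
Proof.
rewrite map_cat filter_cat -[RHS]cats0 -map_comp; congr (_ ++ _).
  by rewrite (eq_in_filter (a2 := predT)) ?filter_predT// => s /mapP[a _ ->];
    rewrite is_branch_node.
rewrite filter_map -[RHS]/(map node [::]); congr map; apply/eqP.
rewrite -size_eq0 size_filter -leqn0 leqNgt -has_count; apply/hasPn => f.
move=> /flatten_mapP[i _ /nseqP[-> _]].
by rewrite /preim/= is_branch_node.
Qed.

Lemma label_slots i j c q :
  count (has_label i) (map node (slots j c q)) = q i.
Proof.
rewrite map_cat count_cat -map_comp.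
rewrite (_ : count _ [seq _ | _ <- iota 0 c] = 0) ?add0n; last first.
  apply/eqP; rewrite -leqn0 leqNgt -has_count; apply/hasPn => s /mapP[a _ ->].
  by rewrite /= has_label_node.
rewrite count_map count_flatten -map_comp sumnE big_map big_enum (bigD1 i)//=.
rewrite count_nseq /preim/= has_label_node eqxx mul1n big1 ?addn0// => i' ne.
by rewrite count_nseq /preim/= has_label_node eqE/= (negbTE ne).
Qed.

Let state_nextE j a v : j < k + l -> a <= n ->
  state_next (branch_state j a) v = nth (branch_state 0 0)
    (slots (next_level j) (width j.+1) (fun i => (2 * remainder j i) %/ Z))
    (a.*2 + v).
Proof.
by move=> j_lt a_le; rewrite {1}/branch_state /state_next val_insubd j_lt inordK.
Qed.

Lemma children_branch_state j : j < k + l ->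
  children [seq node (branch_state j a) | a <- iota 0 (width j)] =
  map node (slots (next_level j) (width j.+1) (fun i => (2 * remainder j i) %/ Z)).
Proof.
move=> j_lt; set L := slots _ _ _.
have szL : size L = (width j).*2 by rewrite size_slots widthS.
rewrite -[in RHS](flatten_nth_pairs (branch_state 0 0) szL) map_flatten.
rewrite /children -!map_comp; congr flatten; apply/eq_in_map => a.
rewrite mem_iota add0n => /= a_lt; rewrite fin_nodeK.
by rewrite !state_nextE ?(leq_trans (ltnW a_lt)) ?width_leq// addn0 addn1.
Qed.

Lemma frontier_ky_tree0 :
  frontier ky_tree 0 = map node (slots 0 (width 0) (fun i => M i %/ Z)).
Proof.
rewrite /frontier /= /state_root.
have: size (slots 0 (width 0) (fun i => M i %/ Z)) = 1.
  by rewrite size_slots width0.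
by case: slots => [|f []].
Qed.

Lemma branch_frontier_ky_tree t : seq.filter (@is_branch n ky_tree) (frontier ky_tree t) =
  [seq node (branch_state (level t) a) | a <- iota 0 (width t)].
Proof.
elim: t => [|t IHt]; first by rewrite frontier_ky_tree0 branch_slots.
rewrite branch_frontierS IHt -{1}width_level children_branch_state ?level_lt//.
rewrite branch_slots; congr [seq _ | _ <- iota 0 _].
by congr (_ %/ _); apply: eq_bigr => i _; rewrite !remainderS remainder_level.
Qed.

Lemma label_frontier_ky_tree t i :
  count (has_label i) (frontier ky_tree t) = (2 ^ t * M i) %/ Z.
Proof.
elim: t => [|t IHt]; first by rewrite frontier_ky_tree0 label_slots mul1n.
rewrite label_frontierS IHt branch_frontier_ky_tree -width_level.
by rewrite children_branch_state ?level_lt// label_slots remainder_level floorS.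
Qed.

Lemma ky_tree_leaf_loop (s : nodes ky_tree) v : ~~ is_branch s -> transition s v = s.
Proof.
rewrite -[s](@fin_stateK state) -/(node _); case: (fin_state s) => [[j a]|i].
  by rewrite is_branch_node.
by move=> _; rewrite /= fin_nodeK.
Qed.

(* Before its end, a simple path to a leaf meets branch nodes only; it is back at
   level [k] every [l] steps, and each time at a new one of the [width k] nodes. *)
Lemma ky_tree_simple_path (p : seq (nodes ky_tree)) :
  simple_path_to_leaf p -> size p <= k + width k * l.
Proof.
move=> /and3P[rp uniq_p _]; rewrite leqNgt; apply/negP => p_gt.
pose r := ddg_root ky_tree; pose x t := nth r (r :: p) t.
have x_inj t t' : t <= size p -> t' <= size p -> x t = x t' -> t = t'.
  by move=> tp t'p /eqP; rewrite nth_uniq// => /eqP.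
(* A leaf loops to itself, so a path going on from it would repeat it. *)
have x_branch t : t < size p -> is_branch (x t).
  move=> tp; apply/negPn/negP => leaf_t.
  have /existsP[v] := pathP r rp t tp.
  rewrite ky_tree_leaf_loop// => /eqP /(x_inj t t.+1 (ltnW tp) tp) /eqP.
  by rewrite ltn_eqF.
(* One visit more than level [k] has branch nodes, for a pigeonhole contradiction. *)
pose visits := [seq x (k + c * l) | c <- iota 0 (width k).+1].
have visit_lt c : c <= width k -> k + c * l < size p.
  by move=> cw; rewrite (leq_ltn_trans _ p_gt)// leq_add2l leq_mul2r cw orbT.
have uniq_visits : uniq visits.
  rewrite map_inj_in_uniq ?iota_uniq// => c c'.
  rewrite !mem_iota !add0n !ltnS => /= cw c'w xx.
  have /addnI/eqP := x_inj _ _ (ltnW (visit_lt c cw)) (ltnW (visit_lt c' c'w)) xx.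
  by rewrite eqn_pmul2r// => /eqP.
suff /(uniq_leq_size uniq_visits) : {subset visits <=
    [seq node (branch_state k a) | a <- iota 0 (width k)]}.
  by rewrite !size_map !size_iota ltnn.
move=> s /mapP[c].
rewrite mem_iota add0n ltnS => /= cw ->.
have := branch_frontier_ky_tree (k + c * l).
rewrite -width_level level_period => <-; rewrite mem_filter x_branch ?visit_lt//.
by apply: path_frontier rp (ltnW (visit_lt c cw)); exact: ky_tree_leaf_loop.
Qed.

Lemma ky_tree_precision : exists2 c, c <= k + width k * l & uses_precision ky_tree c.
Proof.
have [i _] : exists i : 'I_n, true.
  case: (posnP n) => [n0|n_gt0]; last by exists (Ordinal n_gt0).
  move: Z_gt0; rewrite Z_sum big1 // => i.
  by have := leq_ltn_trans (leq0n i) (ltn_ord i); rewrite n0.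
(* Depth [Z] is enough to meet a leaf [i], because [Z < 2 ^ Z <= 2 ^ Z * M i]. *)
have : has (has_label i) (frontier ky_tree Z).
  rewrite has_count label_frontier_ky_tree divn_gt0//.
  by rewrite (leq_trans (ltnW (ltn_expl Z (ltnSn 1))))// leq_pmulr.
move=> /hasP[s s_frontier /eqP s_label].
apply: (bounded_precision ky_tree_leaf_loop _ s_frontier).
- exact: finite_II.
- by rewrite /is_branch s_label.
- exact: ky_tree_simple_path.
Qed.

End KnuthYao.

Theorem theorem3p5 (R : realType) (d : measure_display)
    (Omega : measurableType d) (P : probability Omega R)
    (b : nat -> {RV P >-> bool}) (hb : fair_bit_source b)
    (n : nat) (hn : (0 < n)%N) (M : 'I_n -> nat)
    (hM : forall i, (0 < M i)%N) (Z : nat) (hZ : Z = (\sum_(i < n) M i)%N) :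
  exists T : ddg n,
    [/\ forall i, output_distribution b T i = (((M i)%:R / Z%:R)%R : R)%:E,
        entropy_optimal b T
      & exists2 k, (k <= Z - 1)%N & uses_precision T k].
Proof.
have Z_gt0 : 0 < Z by rewrite hZ (bigD1 (Ordinal hn))//= addn_gt0 hM.
have [m m_odd Zm] := pfactor_coprime (isT : prime 2) Z_gt0.
set k := logn 2 Z in Zm.
have m_gt0 : 0 < m by move: Z_gt0; rewrite Zm muln_gt0 => /andP[].
have l_gt0 : 0 < totient m by rewrite totient_gt0.
(* Euler gives [2 ^ totient m = 1] modulo [m]; multiplying by [2 ^ k] lifts this to modulo [Z]. *)
have pow_period : 2 ^ (k + totient m) = 2 ^ k %[mod Z].
  rewrite Zm expnD [2 ^ k * 2 ^ _]mulnC -[X in _ = X %[mod _]]mul1n -!muln_modl.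
  by rewrite Euler_exp_totient.
have period i : remainder M Z (k + totient m) i = remainder M Z k i.
  by rewrite /remainder -modnMml pow_period modnMml.
have floorT := label_frontier_ky_tree Z_gt0 hZ l_gt0 period.
exists (ky_tree M Z k l_gt0); split.
- exact: (floor_output hb Z_gt0 floorT).
- exact: (floor_entropy_optimal hb Z_gt0 floorT).
have [c c_le cT] := ky_tree_precision hM Z_gt0 hZ l_gt0 period.
exists c => //; apply: leq_trans c_le _.
(* If [m = 1] the right side is 0, and so is the width, since [Z = 2 ^ k] divides [2 ^ k * M i]. *)
have width_l : width M Z k * totient m <= 2 ^ k * m.-1.
  have [m_gt1|] := ltnP 1 m.
    by rewrite leq_mul ?width_leq_exp// -ltnS prednK ?totient_lt.
  rewrite leq_eqVlt ltnS leqNgt m_gt0 orbF => /eqP m1.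
  rewrite /width big1 ?div0n// => i _.
  by rewrite /remainder Zm m1 mul1n modnMr.
(* The strict inequality [k < 2 ^ k] pays for the [- 1]. *)
rewrite leq_subRL// add1n [X in _ < X](_ : Z = 2 ^ k + 2 ^ k * m.-1).
  by rewrite -addSn leq_add// ltn_expl.
by rewrite -mulnS prednK// mulnC.
Qed.
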